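(* Let $a\neq b$ be complex numbers and let $P,Q\in\mathbb{C}[x]$ satisfy $P(a)=P(b)=0$, $Q(a)=Q(b)=0$; put $p=P'$, $q=Q'$. Suppose the Abel equation $y'=p(x)y^3+q(x)y^2$ has a parametric center on $[a,b]$. Then either $P,Q$ satisfy the Composition Condition on $[a,b]$, or both $P$ and $Q$ are non-definite, $P\in Z(Q)$ and $Q\in Z(P)$.
   Context: Let $\mathcal{P}$ be the space of complex polynomials $R$ with $R(a)=R(b)=0$. The equation $y'=p(x)y^3+\epsilon q(x)y^2$ has a center on $[a,b]$ if every solution with $|y(a)|$ sufficiently small satisfies $y(b)=y(a)$ (continuation along the segment $[a,b]$); the equation $y'=p y^3+q y^2$ has a parametric center on $[a,b]$ if for every $\epsilon\in\mathbb{C}$ the equation $y'=p y^3+\epsilon q y^2$ has a center on $[a,b]$. Polynomials $P,Q$ satisfy the Composition Condition on $[a,b]$ if there exist polynomials $\widetilde P,\widetilde Q,W$ with $W(a)=W(b)$ such that $P=\widetilde P\circ W$ and $Q=\widetilde Q\circ W$. For $P\in\mathcal{P}$, $Z(P)$ is the set of $Q\in\mathcal{P}$ such that $\int_a^b P^i(x)Q'(x)\,dx=0$ for all $i\ge 0$. A polynomial $P\in\mathcal{P}$ is ($[a,b]$-)definite if for every $Q\in\mathcal{P}$ with $Q\in Z(P)$, the pair $P,Q$ satisfies the Composition Condition on $[a,b]$; otherwise it is non-definite. *)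

(* Defs.v *)
(* Complex numbers are R[i] for an
   arbitrary R : realType (every realType is a copy of the real numbers). *)
From HB Require Import structures.
From mathcomp Require Import all_boot all_order all_algebra.
From mathcomp Require Import complex.
From mathcomp Require Import all_classical all_reals all_analysis.

Set Implicit Arguments.
Unset Strict Implicit.
Unset Printing Implicit Defensive.

Import Order.TTheory GRing.Theory Num.Theory.
Import numFieldNormedType.Exports.
Local Open Scope classical_set_scope.
Local Open Scope ring_scope.

Section AbelDefs.
Variable R : realType.
Local Notation C := R[i].

Definition seg (a b : C) (t : R) : C := a + (t%:C)%C * (b - a).

Definition has_cderiv (Y : R -> C) (t : R) (L : C) : Prop :=
  (fun h : R => (((h%:C)%C)^-1 * (Y (t + h) - Y t) : C^o)) @ 0^'
    --> (L : C^o).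

(* Y is a solution, along the segment [a,b] (x = seg a b t, t in [0,1]),
   of the equation  y' = p(x) y^3 + eps q(x) y^2 *)
Definition abel_solution (a b : C) (p q : {poly C}) (eps : C) (Y : R -> C)
  : Prop :=
  {within `[0, 1], continuous (fun t : R => (Y t : C^o))} /\
  forall t : R, 0 < t < 1 ->
    has_cderiv Y t
      ((b - a) * (p.[seg a b t] * Y t ^+ 3 + eps * q.[seg a b t] * Y t ^+ 2)).

Definition has_center (a b : C) (p q : {poly C}) (eps : C) : Prop :=
  exists2 delta : R, 0 < delta &
    forall y0 : C, `|y0| < delta%:C%C ->
      (exists Y, abel_solution a b p q eps Y /\ Y 0 = y0) /\
      (forall Y, abel_solution a b p q eps Y -> Y 0 = y0 -> Y 1 = y0).

Definition parametric_center (a b : C) (p q : {poly C}) : Prop :=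
  forall eps : C, has_center a b p q eps.

Definition in_calP (a b : C) (R0 : {poly C}) : Prop :=
  R0.[a] = 0 /\ R0.[b] = 0.

Definition composition_condition (a b : C) (P Q : {poly C}) : Prop :=
  exists Pt Qt W : {poly C},
    W.[a] = W.[b] /\ P = Pt \Po W /\ Q = Qt \Po W.

Definition seg_integral (a b : C) (f : C -> C) : C :=
  let g := fun t : R => f (seg a b t) * (b - a) in
  Complex (Rintegral (@lebesgue_measure R) `[0, 1] (fun t => complex.Re (g t)))
          (Rintegral (@lebesgue_measure R) `[0, 1] (fun t => complex.Im (g t))).

Definition in_Z (a b : C) (P Q : {poly C}) : Prop :=
  in_calP a b Q /\
  forall i : nat, seg_integral a b (fun x => (P ^+ i * Q^`()).[x]) = 0.

Definition definite (a b : C) (P : {poly C}) : Prop :=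
  in_calP a b P /\
  forall Q : {poly C}, in_calP a b Q -> in_Z a b P Q ->
    composition_condition a b P Q.

End AbelDefs.

(* Main.v *)
(* Rather than the Poincare map, which depends nonlinearly on the data, expand a
   first integral sum_n h_n(x) y^(n-2) with h_0 = 1 and h_n(a) = 0 for n > 0: its
   coefficients satisfy the linear recursion
     h_(n+2)' = - (n-1) eps q h_(n+1) - (n-2) p h_n.
   A solution with small y(a) = r stays comparable to r, so the truncations of
   the first integral vary along it by a controlled power of r, and a center
   forces h_n(b) = 0 for all n > 0. As this holds for every eps, each coefficient
   of h_n as a polynomial in eps vanishes at b. Because the expansion starts with
   y^-2, the parts of degree 1 in q (resp. in p) form a chain of iterated
   integrals against p (resp. q), from which integration by parts extracts the
   moments of P^i q (resp. Q^i p). Hence Q is in Z(P) and P is in Z(Q), and if P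
   or Q is definite, the Composition Condition follows by definition. *)
Require Import Defs.
From HB Require Import structures.
From mathcomp Require Import all_boot all_order all_algebra.
From mathcomp Require Import complex.
From mathcomp Require Import all_classical all_reals all_analysis.
From mathcomp Require Import ring lra.

Set Implicit Arguments.
Unset Strict Implicit.
Unset Printing Implicit Defensive.

Import Order.TTheory GRing.Theory Num.Theory.
Import numFieldNormedType.Exports.
Import ComplexField.Normc.
Local Open Scope classical_set_scope.
Local Open Scope ring_scope.

(** * Polynomial primitives and the coefficients of the first integral *)

Section Algebra.
Variable C : numFieldType.
Implicit Types (a b : C) (p q A f : {poly C}).

(** At [i = 0] the coefficient is a division by zero, hence 0; vanishing at [a] then fixes the
    constant term. *)
Definition primitive a p : {poly C} :=
  let F := \poly_(i < (size p).+1) (p`_i.-1 / i%:R) in F - F.[a]%:P.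

Lemma deriv_primitive a p : (primitive a p)^`() = p.
Proof.
rewrite /primitive derivB derivC subr0; apply/polyP => i.
rewrite coef_deriv coef_poly ltnS /=; case: ltnP => [_|le_pi].
  by rewrite -[LHS]mulr_natr mulfVK // pnatr_eq0.
by rewrite mul0rn nth_default.
Qed.

Lemma primitive_root a p : (primitive a p).[a] = 0.
Proof. by rewrite /primitive hornerD hornerN hornerC subrr. Qed.

Lemma primitive0 a : primitive a 0 = 0.
Proof.
rewrite /primitive; set F := \poly_(i < _) _.
suff -> : F = 0 by rewrite horner0 subr0.
by apply/polyP => i; rewrite coef_poly !coef0 mul0r if_same.
Qed.

Lemma horner_primitive_map (K : {poly {poly C}}) a (e : C) :
  (map_poly (primitive a) K).[e%:P] =
  \sum_(i < size K) primitive a K`_i * (e ^+ i)%:P.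
Proof.
rewrite (@horner_coef_wide _ (size K)) ?size_poly //.
by apply: eq_bigr => i _; rewrite coef_map_id0 ?primitive0 // polyC_exp.
Qed.

Lemma deriv_horner_primitive (K : {poly {poly C}}) a (e : C) :
  ((map_poly (primitive a) K).[e%:P])^`() = K.[e%:P].
Proof.
rewrite horner_primitive_map raddf_sum horner_coef; apply: eq_bigr => i _ /=.
by rewrite derivM deriv_primitive derivC mulr0 addr0 polyC_exp.
Qed.

Lemma horner_primitive_root (K : {poly {poly C}}) a (e : C) :
  (map_poly (primitive a) K).[e%:P].[a] = 0.
Proof.
rewrite horner_primitive_map horner_sum big1 // => i _ /=.
by rewrite hornerM primitive_root mul0r.
Qed.

Lemma poly_fun_eq0 (r : {poly C}) : (forall x, r.[x] = 0) -> r = 0.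
Proof.
move=> r0; apply/eqP; apply: contraT => nz_r.
(* In characteristic 0 the numbers 0, ..., [size r - 1] are [size r] distinct roots, one too many
   for a nonzero [r]. *)
have := max_poly_roots nz_r (rs := [seq i%:R | i <- iota 0 (size r)]).
rewrite size_map size_iota ltnn => -> //.
  by apply/allP => x _; rewrite rootE r0.
by rewrite map_inj_uniq ?iota_uniq // => i j /eqP; rewrite eqr_nat => /eqP.
Qed.

(** In characteristic 0 a zero derivative forces a constant. Coefficients of [fi] are identified
    this way below, from their derivative and their value at [a]. *)
Lemma deriv_eq a p q : p.[a] = q.[a] -> p^`() = q^`() -> p = q.
Proof.
move=> pqa dpq; apply/eqP; rewrite -subr_eq0; pose d : {poly C} := p - q.
rewrite -/d.
have dd : d^`() = 0 by rewrite derivB dpq subrr.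
have dcst : d = (d`_0)%:P.
  apply/polyP => -[|i]; rewrite coefC //=.
  have /eqP := congr1 (fun r : {poly C} => r`_i) dd.
  by rewrite coef_deriv coef0 mulrn_eq0 /= => /eqP.
have : d.[a] = 0 by rewrite hornerD hornerN pqa subrr.
by rewrite dcst hornerC => ->.
Qed.

(** Algebraic form of a vanishing integral of [f] from [a] to [b]; it makes sense over any
    [numFieldType]. *)
Definition closed_primitive a b f :=
  exists2 G : {poly C}, G^`() = f & G.[a] = G.[b].

(* Integrating by parts trades a factor A for a step n -> n+1 along the
   sequence, and the boundary terms vanish. *)
Lemma closed_primitive_chain a b A (w : nat -> {poly C}) (beta : nat -> C) :
  (forall n, (w n).[a] = 0) -> (forall n, (w n).[b] = 0) ->
  (forall n, beta n != 0) ->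
  (forall n, (w n.+1)^`() = - (beta n *: (A^`() * w n))) ->
  forall i n, closed_primitive a b (A ^+ i * (w n)^`()).
Proof.
move=> wa wb beta0 dw; elim=> [|i IH] n.
  by exists (w n); rewrite ?expr0 ?mul1r // wa wb.
have [G dG Gab] := IH n.+1.
(* Since G' = -beta_n A^i A' w_n, the weight (i+1)/beta_n cancels the term (i+1) A^i A' w_n. *)
exists (A ^+ i.+1 * w n + (i.+1%:R / beta n) *: G); last first.
  by rewrite !hornerE Gab wa wb !mulr0.
rewrite derivD derivM derivZ dG dw deriv_exp /=.
rewrite -mulr_natl -mul_polyC -mul_polyC.
have bV : (beta n)%:P * (beta n)^-1%:P = 1 :> {poly C}.
  by rewrite -polyCM divff.
rewrite polyCM -polyC_natr.
ring: bV.
Qed.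

(* Coefficients h_n of the first integral sum_n h_n y^(n-2) of
   y' = p y^3 + eps q y^2, as polynomials in eps over C[x]. *)
Variables (a : C) (p q : {poly C}).

(** The pair holds h_n and h_(n+1), as the recursion looks two steps back; its base h_1' = 2 eps q
    is the case n = -1 with h_(-1) = 0. Integer factors allow m - 1 and m - 2 to be negative. *)
Fixpoint fi_pair n : {poly {poly C}} * {poly {poly C}} :=
  if n is m.+1 then
    ((fi_pair m).2, map_poly (primitive a)
      (- (q%:P * 'X * (fi_pair m).2 *~ (m%:Z - 1)
          + p%:P * (fi_pair m).1 *~ (m%:Z - 2))))
  else (1, map_poly (primitive a) (q%:P * 'X *+ 2)).

Definition fi n := (fi_pair n).1.

Lemma hornerMz (T : comNzRingType) (r : {poly T}) (z : int) x :
  (r *~ z).[x] = r.[x] *~ z.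
Proof. exact: (raddfMz (horner_eval x)). Qed.

Lemma deriv_fi1_horner e : (fi 1).[e%:P]^`() = (2 * e) *: q.
Proof.
rewrite deriv_horner_primitive hornerMn hornerM hornerC hornerX.
by rewrite mulrC mul_polyC -mulr_natl -scalerA scaler_nat mulr_natl.
Qed.

Lemma deriv_fi_horner e n : (fi n.+2).[e%:P]^`() =
  - (((n%:R - 1) * e) *: (q * (fi n.+1).[e%:P])
     + (n%:R - 2) *: (p * (fi n).[e%:P])).
Proof.
rewrite deriv_horner_primitive hornerN hornerD; congr (- (_ + _)).
  rewrite hornerMz !hornerM hornerX hornerC /=.
  rewrite -scalerA -[e *: _]mul_polyC [e%:P * _]mulrCA mulrA.
  by rewrite -scaler_int intrB -pmulrn.
rewrite hornerMz hornerM hornerC /=.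
by rewrite -scaler_int intrB -pmulrn.
Qed.

Lemma fi_horner_root e n : (fi n.+1).[e%:P].[a] = 0.
Proof. by case: n => [|n]; exact: horner_primitive_root. Qed.

(** Evaluating the coefficients at x = b leaves a polynomial in eps alone, which vanishes at every
    [e] and hence identically. *)
Lemma coef_fi_root b n : (forall e, (fi n).[e%:P].[b] = 0) ->
  forall j, ((fi n)`_j).[b] = 0.
Proof.
move=> fb j; pose r := map_poly (horner_eval b) (fi n).
suff r0 : r = 0 by rewrite -[LHS]/(horner_eval b _) -coef_map -/r r0 coef0.
apply: poly_fun_eq0 => e; rewrite -(fb e) -[RHS]/(horner_eval b _) -horner_map.
by rewrite /= /horner_eval hornerC.
Qed.

Lemma deriv_fi1 j : ((fi 1)`_j)^`() = if j == 1%N then q *+ 2 else 0.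
Proof.
rewrite coef_map_id0 ?primitive0 // deriv_primitive coefMn coefMX coefC.
by case: j => [|[|j]]; rewrite //= mul0rn.
Qed.

Lemma deriv_fi n j : ((fi n.+2)`_j)^`() =
  - (q * (if j is k.+1 then (fi n.+1)`_k else 0) *~ (n%:Z - 1)
     + p * (fi n)`_j *~ (n%:Z - 2)).
Proof.
rewrite coef_map_id0 ?primitive0 // deriv_primitive coefN coefD.
rewrite !coefMrz -mulrA !coefCM coefXM.
by case: j.
Qed.

Lemma fi_root n j : (0 < n)%N -> ((fi n)`_j).[a] = 0.
Proof.
by case: n => [|[|n]] // _; rewrite coef_map_id0 ?primitive0 ?primitive_root.
Qed.

(** Each step of the recursion multiplies by eps at most once. *)
Lemma size_fi n : (size (fi n) <= n.+1)%N.
Proof.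
suff: (size (fi n) <= n.+1)%N /\ (size (fi n.+1) <= n.+2)%N by case.
elim: n => [|n [IH1 IH2]].
  split; first by rewrite size_poly1.
  apply/leq_sizeP => j le2j; rewrite coef_map_id0 ?primitive0 //.
  rewrite coefMn coefMX coefC; case: j le2j => [|[|j]] //= _.
  by rewrite mul0rn primitive0.
split=> //; apply/leq_sizeP => j le3j.
apply: (@deriv_eq a); first by rewrite fi_root // horner0.
rewrite deriv_fi linear0; case: j le3j => // j le3j.
rewrite !nth_default ?(leq_trans IH1) ?(leq_trans IH2) //.
  by rewrite !mulr0 !mul0rz addr0 oppr0.
exact: ltnW (ltnW _).
Qed.

Lemma fi_eq0 n j : (n < j)%N -> (fi n)`_j = 0.
Proof. by move=> ltnj; rewrite nth_default // (leq_trans (size_fi n)). Qed.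

(** The factor n - 2 kills the eps-free part of h_4, and this zero propagates in steps of two. *)
Lemma fi_even_eps0 i : (fi i.+2.*2)`_0 = 0.
Proof.
elim: i => [|i IH]; apply: (@deriv_eq a); rewrite ?fi_root ?horner0 //.
  by rewrite deriv_fi mulr0 mul0rz subrr mulr0z addr0 oppr0 linear0.
rewrite doubleS deriv_fi mulr0 mul0rz IH mulr0 mul0rz.
by rewrite addr0 oppr0 linear0.
Qed.

(** The factor n - 1 vanishes at n = 1 and h_1 has degree at most 1 in eps, so h_3 has no eps^3
    term; the recursion passes this along the diagonal. *)
Lemma fi_diag_eq0 i : (fi i.+3)`_i.+3 = 0.
Proof.
elim: i => [|i IH]; apply: (@deriv_eq a); rewrite ?fi_root ?horner0 //.
  rewrite deriv_fi subrr mulr0z (@fi_eq0 1) // mulr0 mul0rz addr0 oppr0.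
  by rewrite linear0.
by rewrite deriv_fi IH fi_eq0 // !mulr0 !mul0rz addr0 oppr0 linear0.
Qed.

End Algebra.

(** * Moments extracted from the values of the coefficients at b *)

Section Moments.
Variable C : numFieldType.
Variables (a b : C) (P Q : {poly C}).
Hypotheses (Pa : P.[a] = 0) (Pb : P.[b] = 0) (Qa : Q.[a] = 0).
Let h := fi a P^`() Q^`().
Hypothesis hb : forall n j, (0 < n)%N -> ((h n)`_j).[b] = 0.

(* For eps = 0 the first integral is exactly y^-2 + 2P, so the part w_n of
   degree 1 in eps is fed only by w_(n-1), starting from w_0 = 2Q. *)
Lemma closed_primitive_momentP i : closed_primitive a b (P ^+ i * Q^`()).
Proof.
pose w n := (h n.*2.+1)`_1.
(* This is 2n - 1, nonzero because it is odd. *)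
pose beta n : C := (n.*2.+1%:Z - 2)%:~R.
have dw n : (w n.+1)^`() = - (beta n *: (P^`() * w n)).
  rewrite /w /h doubleS deriv_fi; congr (- _).
  rewrite [X in X + _](_ : _ = 0) ?add0r ?scaler_int //.
  (* For n = 0 the coefficient (h_2)_0 = 2P is not the zero polynomial in general, but its factor 2n
     vanishes. *)
  case: n => [|n]; first by rewrite subrr mulr0z.
  by rewrite -doubleS fi_even_eps0 mulr0 mul0rz.
have beta0 n : beta n != 0.
  rewrite intr_eq0 subr_eq0; apply/eqP => -[] /(congr1 odd).
  by rewrite /= odd_double.
have wa n : (w n).[a] = 0 by exact: fi_root.
have wb n : (w n).[b] = 0 by exact: hb.
have [G dG Gab] := closed_primitive_chain wa wb beta0 dw i 0.
exists (2^-1 *: G); rewrite ?hornerZ ?Gab // derivZ dG.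
rewrite /w deriv_fi1 eqxx mulrnAr -[X in _ *: X]scaler_nat scalerA.
by rewrite mulVf ?scale1r ?pnatr_eq0.
Qed.

(* For p = 0 the first integral is exactly (1/y + eps Q)^2, so the part w_n of
   degree 1 in p is fed only by w_(n-1), starting from w_0' = 2Q P'. *)
Lemma closed_primitive_momentQ i : closed_primitive a b (Q ^+ i * P^`()).
Proof.
(* The chain below starts from w_0' = 2 Q P', which already carries a factor Q, so it only reaches
   positive exponents. *)
case: i => [|i]; first by exists P; rewrite ?expr0 ?mul1r ?Pa ?Pb.
pose w n := (h n.+3)`_n.+1.
have dw n : (w n.+1)^`() = - (n.+1%:R *: (Q^`() * w n)).
  rewrite /w /h deriv_fi; congr (- _).
  rewrite [X in _ + X](_ : _ = 0) ?addr0.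
    by rewrite -scaler_int; congr (_ *: _); rewrite -addn2 PoszD addrK.
  (* For n = 0 the coefficient is (h_2)_2 = Q^2, removed by its factor n. *)
  by case: n => [|n]; rewrite ?subrr ?mulr0z // fi_diag_eq0 mulr0 mul0rz.
have beta0 n : n.+1%:R != 0 :> C by rewrite pnatr_eq0.
have wa n : (w n).[a] = 0 by exact: fi_root.
have wb n : (w n).[b] = 0 by exact: hb.
have [G dG Gab] := closed_primitive_chain wa wb beta0 dw i 0.
have h1Q : (h 1)`_1 = Q *+ 2.
  apply: (@deriv_eq _ a); first by rewrite fi_root // hornerMn Qa mul0rn.
  by rewrite deriv_fi1 derivMn.
exists (2^-1 *: G); rewrite ?hornerZ ?Gab // derivZ dG.
rewrite /w /h deriv_fi -/h h1Q subrr mulr0z add0r.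
have -> : (1%:Z - 2 = - 1)%R by [].
rewrite mulrN1z opprK !mulrnAr -[X in _ *: X]scaler_nat scalerA.
by rewrite mulVf ?scale1r ?pnatr_eq0 // exprSr -mulrA [P^`() * _]mulrC.
Qed.
End Moments.

Local Open Scope complex_scope.

(** * Limits and derivatives of complex-valued functions of a real variable *)

Section ComplexDerivative.
Variable R : realType.
Local Notation C := R[i].
Implicit Types (Y Z : R -> C) (t : R).

(* Real-valued norms, so that lra and nra apply; the norm of R[i] is itself
   complex-valued. *)
Lemma normr_normc (z : C) : `|z| = (normc z)%:C.
Proof. by case: z => x y; rewrite normc_def. Qed.

Lemma normc_real (r : R) : normc r%:C = `|r|.
Proof. by rewrite /= expr0n addr0 sqrtr_sqr. Qed.

Lemma normc_ge0 (z : C) : 0 <= normc z.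
Proof. by case: z => x y; rewrite sqrtr_ge0. Qed.

Lemma normcX (z : C) n : normc (z ^+ n) = normc z ^+ n.
Proof.
elim: n => [|n IH]; first by rewrite !expr0 normc1.
by rewrite !exprS normcM IH.
Qed.

Lemma normr_Re_le (z : C) : `|complex.Re z| <= normc z.
Proof. by case: z => x y /=; rewrite -sqrtr_sqr ler_wsqrtr // lerDl sqr_ge0. Qed.

Lemma normr_Im_le (z : C) : `|complex.Im z| <= normc z.
Proof. by case: z => x y /=; rewrite -sqrtr_sqr ler_wsqrtr // lerDr sqr_ge0. Qed.

Lemma normc_le_Re_Im (z : C) : normc z <= `|complex.Re z| + `|complex.Im z|.
Proof.
rewrite [z in normc z]complexE (le_trans (le_normcD _ _)) // normcM.
rewrite !normc_real (_ : normc 'i = 1) ?mul1r //.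
by rewrite /= expr0n expr1n add0r sqrtr1.
Qed.

Lemma normc_dist_le (x y : C) : `|normc x - normc y| <= normc (x - y).
Proof.
have le_B u v : normc u - normc v <= normc (u - v).
  by rewrite lerBlDr (le_trans _ (le_normcD _ _)) // subrK.
rewrite ler_norml le_B andbT lerNl opprB.
have -> : normc (x - y) = normc (y - x).
  by rewrite -(normcN (y - x)); congr normc; exact: (esym (opprB y x)).
exact: le_B.
Qed.

Local Notation "Y '@C' F --> l" := ((fun t => (Y t : C^o)) @ F --> (l : C^o))
  (at level 60, F at level 55).

Section Limits.
Context {F : set_system R} {FF : Filter F}.
Implicit Types (l m : C).

(** Turns the complex radii of [cvgrPdist_lt] into real ones: a positive element of [R[i]] is
    real. *)
Lemma cvg_normcP Y l :
  Y @C F --> l <-> forall e : R, 0 < e -> \forall t \near F, normc (l - Y t) < e.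
Proof.
split=> [/cvgrPdist_lt Yl e e0|Yl].
  have := Yl e%:C; rewrite ltcR => /(_ e0).
  by apply: filterS => t; rewrite normr_normc ltcR.
apply/cvgrPdist_lt => e e0.
have eR : e = (complex.Re e)%:C by rewrite RRe_real // realE ltW.
have := Yl (complex.Re e); rewrite -ltcR -eR => /(_ e0).
by apply: filterS => t; rewrite -ltcR -normr_normc -eR.
Qed.

Lemma cvg_Re Y l : Y @C F --> l -> (fun t => complex.Re (Y t)) @ F --> complex.Re l.
Proof.
move=> /cvg_normcP Yl; apply/cvgrPdist_lt => e /Yl; apply: filterS => t.
by apply: le_lt_trans; rewrite -raddfB normr_Re_le.
Qed.

Lemma cvg_Im Y l : Y @C F --> l -> (fun t => complex.Im (Y t)) @ F --> complex.Im l.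
Proof.
move=> /cvg_normcP Yl; apply/cvgrPdist_lt => e /Yl; apply: filterS => t.
by apply: le_lt_trans; rewrite -raddfB normr_Im_le.
Qed.

Lemma cvg_normc Y l : Y @C F --> l -> (fun t => normc (Y t)) @ F --> normc l.
Proof.
move=> /cvg_normcP Yl; apply/cvgrPdist_lt => e /Yl; apply: filterS => t.
exact: le_lt_trans (normc_dist_le _ _).
Qed.

Lemma cvg_realC (f : R -> R) (l : R) : f @ F --> l -> (fun t => (f t)%:C) @C F --> l%:C.
Proof.
move=> /cvgrPdist_lt fl; apply/cvg_normcP => e /fl; apply: filterS => t.
by rewrite -rmorphB normc_real.
Qed.

Lemma cvgC_cst l : (fun=> l) @C F --> l.
Proof. exact: cvg_cst. Qed.

Lemma cvgCD Y Z l m : Y @C F --> l -> Z @C F --> m ->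
  (fun t => Y t + Z t) @C F --> l + m.
Proof. exact: cvgD. Qed.

Lemma cvgCM Y Z l m : Y @C F --> l -> Z @C F --> m ->
  (fun t => Y t * Z t) @C F --> l * m.
Proof. exact: cvgM. Qed.

Lemma cvgCV Y l : l != 0 -> Y @C F --> l -> (fun t => (Y t)^-1) @C F --> l^-1.
Proof. exact: cvgV. Qed.

Lemma cvgC_near Y Z l : (\forall t \near F, Y t = Z t) ->
  Y @C F --> l -> Z @C F --> l.
Proof. by move=> YZ; apply: cvg_trans; exact: near_eq_cvg. Qed.

End Limits.
Arguments cvgC_cst {F FF} l.

Lemma has_cderiv_cvg Y t L : has_cderiv Y t L ->
  (fun h => Y (t + h)) @C (0:R)^' --> Y t.
Proof.
move=> dY.
have h0 : (fun h : R => h%:C) @C (0:R)^' --> (0:R)%:C.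
  by apply: (@cvg_realC _ _ idfun 0); exact: nbhs_dnbhs.
pose proof (cvgCD (cvgCM h0 dY) (cvgC_cst (Y t))) as H.
rewrite mul0r add0r in H; refine (cvgC_near _ H).
near=> h => /=; rewrite mulrA divff ?mul1r ?subrK //.
by rewrite (fmorph_eq0 (real_complex R)); near: h; exact: nbhs_dnbhs_neq.
Unshelve. all: by end_near. Qed.

Lemma has_cderiv_eq Y Z t L M : (forall s, Y s = Z s) -> L = M ->
  has_cderiv Y t L -> has_cderiv Z t M.
Proof. by move=> /funext -> ->. Qed.

Lemma has_cderiv_cst (c : C) t : has_cderiv (fun=> c) t 0.
Proof.
by refine (cvgC_near _ (cvgC_cst 0)); near=> h; rewrite subrr mulr0.
Unshelve. all: by end_near. Qed.

Lemma has_cderiv_real t : has_cderiv (fun s => s%:C) t 1.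
Proof.
refine (cvgC_near _ (cvgC_cst 1)); near=> h.
rewrite -rmorphB /= [t + h]addrC addrK mulVf // (fmorph_eq0 (real_complex R)).
by near: h; exact: nbhs_dnbhs_neq.
Unshelve. all: by end_near. Qed.

Lemma has_cderivD Y Z t L M : has_cderiv Y t L -> has_cderiv Z t M ->
  has_cderiv (fun s => Y s + Z s) t (L + M).
Proof.
move=> dY dZ; refine (cvgC_near _ (cvgCD dY dZ)).
by near=> h => /=; ring.
Unshelve. all: by end_near. Qed.

Lemma has_cderivM Y Z t L M : has_cderiv Y t L -> has_cderiv Z t M ->
  has_cderiv (fun s => Y s * Z s) t (L * Z t + Y t * M).
Proof.
move=> dY dZ.
refine (cvgC_near _ (cvgCD (cvgCM dY (has_cderiv_cvg dZ)) (cvgCM (cvgC_cst (Y t)) dZ))).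
by near=> h => /=; ring.
Unshelve. all: by end_near. Qed.

Lemma has_cderivX Y t L n : has_cderiv Y t L ->
  has_cderiv (fun s => Y s ^+ n) t (L * Y t ^+ n.-1 *+ n).
Proof.
move=> dY; elim: n => [|n IH].
  by rewrite mulr0n; apply: has_cderiv_eq (has_cderiv_cst 1 t).
apply: has_cderiv_eq (has_cderivM dY IH) => [s|]; first by rewrite exprS.
rewrite mulrS mulrnAr; congr (_ + _).
by case: n {IH} => [|n]; rewrite ?mulr0n //= mulrCA -exprS.
Qed.

Lemma has_cderivV Y t L : Y t != 0 -> has_cderiv Y t L ->
  has_cderiv (fun s => (Y s)^-1) t (- L / Y t ^+ 2).
Proof.
move=> Yt0 dY; have Yc := has_cderiv_cvg dY.
(* The difference quotient of 1/Y simplifies only where Y(t + h) is nonzero, which continuity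
   ensures near 0. *)
have Yn0 : \forall h \near (0:R)^', Y (t + h) != 0.
  have n0 : 0 < normc (Y t).
    rewrite lt_neqAle normc_ge0 andbT eq_sym.
    by apply: contra Yt0 => /eqP/eq0_normc ->.
  have /cvg_normcP/(_ _ n0) := Yc; apply: filterS => h.
  by apply: contraTneq => ->; rewrite subr0 ltxx.
pose proof (cvgCM (cvgC_cst (- (Y t)^-1)) (cvgCV Yt0 Yc)) as YM.
have -> : - L / Y t ^+ 2 = L * (- (Y t)^-1 * (Y t)^-1) by field.
refine (cvgC_near _ (cvgCM dY YM)).
near=> h => /=.
have h0 : h%:C != 0 :> C.
  by rewrite (fmorph_eq0 (real_complex R)); near: h; exact: nbhs_dnbhs_neq.
have Yh0 : Y (t + h) != 0 by near: h.
by move: (h%:C) h0 => k k0; field; rewrite Yt0 Yh0 k0.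
Unshelve. all: by end_near. Qed.

Lemma has_cderiv_horner (a b : C) (p : {poly C}) t :
  has_cderiv (fun s => p.[seg a b s]) t ((b - a) * p^`().[seg a b t]).
Proof.
have dseg : has_cderiv (seg a b) t (b - a).
  apply: has_cderiv_eq (has_cderivD (has_cderiv_cst a t)
    (has_cderivM (has_cderiv_real t) (has_cderiv_cst (b - a) t))) => //.
  by rewrite mulr0 mul1r addr0 add0r.
elim/poly_ind: p => [|p c IH].
  apply: has_cderiv_eq (has_cderiv_cst 0 t) => [s|]; first by rewrite horner0.
  by rewrite linear0 horner0 mulr0.
apply: has_cderiv_eq (has_cderivD (has_cderivM IH dseg) (has_cderiv_cst c t)) => [s|].
  by rewrite !hornerE.
by rewrite derivD derivM derivX derivC !hornerE; ring.
Qed.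

Lemma is_derive_cvg (f : R -> R) t l :
  (fun h => h^-1 * (f (t + h) - f t)) @ (0:R)^' --> l -> is_derive t 1 f l.
Proof.
move=> fl; have {}fl : (fun h : R => h^-1 *: ((f \o shift t) (h *: 1) - f t)) @
    (0:R)^' --> l.
  apply: cvg_trans fl; apply: near_eq_cvg; near=> h.
  by rewrite /= /shift [h *: 1]mulr1 [h + t]addrC.
by split; [apply: cvgP fl | apply: cvg_lim fl].
Unshelve. all: by end_near. Qed.

Lemma is_derive_Re Y t L : has_cderiv Y t L ->
  is_derive t 1 (fun s => complex.Re (Y s)) (complex.Re L).
Proof.
move=> /cvg_Re dY; apply: is_derive_cvg; apply: cvg_trans dY.
apply: near_eq_cvg; near=> h.
rewrite -raddfB; case: (Y (t + h) - Y t) => x y.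
by rewrite -rmorphV ?unitfE /= ?mul0r ?subr0 //; near: h; exact: nbhs_dnbhs_neq.
Unshelve. all: by end_near. Qed.

Lemma is_derive_Im Y t L : has_cderiv Y t L ->
  is_derive t 1 (fun s => complex.Im (Y s)) (complex.Im L).
Proof.
move=> /cvg_Im dY; apply: is_derive_cvg; apply: cvg_trans dY.
apply: near_eq_cvg; near=> h.
rewrite -raddfB; case: (Y (t + h) - Y t) => x y.
by rewrite -rmorphV ?unitfE /= ?mul0r ?addr0 //; near: h; exact: nbhs_dnbhs_neq.
Unshelve. all: by end_near. Qed.

End ComplexDerivative.
Arguments has_cderiv_cst {R} c t.
Arguments has_cderiv_real {R} t.
Arguments has_cderiv_horner {R} a b p t.
Arguments has_cderivX {R Y t L} n _.

(** * Integration of polynomials along the segment *)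

Section SegmentIntegral.
Variable R : realType.
Local Notation C := R[i].

Lemma Rintegral_derive (f F : R -> R) (a b : R) : a < b ->
  (forall t : R, is_derive t 1 F (f t)) -> (forall t, {for t, continuous f}) ->
  Rintegral (@lebesgue_measure R) `[a, b] f = F b - F a.
Proof.
move=> ab dF cf.
have cF t : {for t, continuous F}.
  by apply: differentiable_continuous; apply/derivable1_diffP; case: (dF t).
rewrite /Rintegral (@continuous_FTC2 _ f F) //.
- by apply: continuous_subspaceT => t; exact: cf.
- split=> [t _||]; first by case: (dF t).
  + by apply: cvg_at_right_filter; exact: cF.
  + by apply: cvg_at_left_filter; exact: cF.
- by move=> t _; rewrite derive1E; case: (dF t).
Qed.

Lemma seg_integral_primitive (a b : C) (F : {poly C}) :
  seg_integral a b (fun x => F^`().[x]) = F.[b] - F.[a].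
Proof.
have seg0 : seg a b 0 = a by rewrite /seg mul0r addr0.
have seg1 : seg a b 1 = b by rewrite /seg mul1r addrC subrK.
(* With b - a absorbed into a polynomial, the integrand is continuous because polynomials are
   differentiable along the segment. *)
pose g := F^`() * (b - a)%:P.
have gE t : F^`().[seg a b t] * (b - a) = g.[seg a b t] by rewrite !hornerE.
have dF t : has_cderiv (fun s => F.[seg a b s]) t g.[seg a b t].
  by apply: has_cderiv_eq (has_cderiv_horner a b F t) => //; rewrite -gE mulrC.
have dg t := has_cderiv_horner a b g t.
have IE (f : C -> R) : Rintegral (@lebesgue_measure R) `[0, 1]
    (fun t => f (F^`().[seg a b t] * (b - a)))
  = Rintegral (@lebesgue_measure R) `[0, 1] (fun t => f g.[seg a b t]).
  by congr Rintegral; apply/funext => t; rewrite gE.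
have cRe t : {for t, continuous (fun s => complex.Re g.[seg a b s])}.
  apply: differentiable_continuous; apply/derivable1_diffP.
  by case: (is_derive_Re (has_cderiv_horner a b g t)).
have cIm t : {for t, continuous (fun s => complex.Im g.[seg a b s])}.
  apply: differentiable_continuous; apply/derivable1_diffP.
  by case: (is_derive_Im (has_cderiv_horner a b g t)).
rewrite /seg_integral; cbv zeta; rewrite !IE.
rewrite (Rintegral_derive ltr01 (fun t => is_derive_Re (dF t)) cRe).
rewrite (Rintegral_derive ltr01 (fun t => is_derive_Im (dF t)) cIm) seg0 seg1.
by case: (F.[a]) => ? ?; case: (F.[b]) => ? ?.
Qed.
End SegmentIntegral.

(** * Continuity on the parameter interval, continuous induction and the mean value inequality *)

Section MeanValue.
Variable R : realType.
Local Notation C := R[i].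
Implicit Types (Y Z : R -> C) (A : set R).

Lemma continuous_Re A Y :
  {within A, continuous (fun t => (Y t : C^o))} ->
  {within A, continuous (fun t => complex.Re (Y t))}.
Proof. by move=> cY t; exact (@cvg_Re R (nbhs (t : subspace A)) _ Y _ (cY t)). Qed.

Lemma continuous_Im A Y :
  {within A, continuous (fun t => (Y t : C^o))} ->
  {within A, continuous (fun t => complex.Im (Y t))}.
Proof. by move=> cY t; exact (@cvg_Im R (nbhs (t : subspace A)) _ Y _ (cY t)). Qed.

Lemma continuousC_cst A (c : C) : {within A, continuous (fun=> (c : C^o))}.
Proof. by move=> t; exact: cvg_cst. Qed.

Lemma continuousCD A Y Z :
  {within A, continuous (fun t => (Y t : C^o))} ->
  {within A, continuous (fun t => (Z t : C^o))} ->
  {within A, continuous (fun t => (Y t + Z t : C^o))}.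
Proof.
by move=> cY cZ t; exact (@cvgCD R (nbhs (t : subspace A)) _ Y Z _ _ (cY t) (cZ t)).
Qed.

Lemma continuousCM A Y Z :
  {within A, continuous (fun t => (Y t : C^o))} ->
  {within A, continuous (fun t => (Z t : C^o))} ->
  {within A, continuous (fun t => (Y t * Z t : C^o))}.
Proof.
by move=> cY cZ t; exact (@cvgCM R (nbhs (t : subspace A)) _ Y Z _ _ (cY t) (cZ t)).
Qed.

Lemma continuousCX A Y n :
  {within A, continuous (fun t => (Y t : C^o))} ->
  {within A, continuous (fun t => (Y t ^+ n : C^o))}.
Proof.
move=> cY; elim: n => [|n IH]; first exact: continuousC_cst.
rewrite (_ : (fun t => Y t ^+ n.+1) = fun t => Y t * Y t ^+ n).
  exact: continuousCM.
by apply/funext => t; rewrite exprS.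
Qed.

Lemma continuousC_sum A n (F : nat -> R -> C) :
  (forall i, {within A, continuous (fun t => (F i t : C^o))}) ->
  {within A, continuous (fun t => (\sum_(i < n) F i t : C^o))}.
Proof.
move=> cF; elim: n => [|n IH].
  rewrite (_ : (fun t => _) = fun=> 0); first exact: continuousC_cst.
  by apply/funext => t; rewrite big_ord0.
rewrite (_ : (fun t => _) = fun t => \sum_(i < n) F i t + F n t).
  exact: continuousCD.
by apply/funext => t; rewrite big_ord_recr.
Qed.

Lemma continuous_normc A Y :
  {within A, continuous (fun t => (Y t : C^o))} ->
  {within A, continuous (fun t => normc (Y t))}.
Proof. by move=> cY t; exact (@cvg_normc R (nbhs (t : subspace A)) _ Y _ (cY t)). Qed.

Lemma continuousC_V A Y :
  (forall t, A t -> Y t != 0) ->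
  {within A, continuous (fun t => (Y t : C^o))} ->
  {within A, continuous (fun t => ((Y t)^-1 : C^o))}.
Proof.
move=> Y0 cY t; have [At|nAt] := pselect (A t).
  by exact (@cvgCV R (nbhs (t : subspace A)) _ Y _ (Y0 t At) (cY t)).
(* Outside [A] the neighbourhoods of [t] in the subspace are principal, so even a zero of Y does no
   harm. *)
move=> B /nbhs_singleton Bt; change (nbhs_subspace t ((fun t => (Y t)^-1) @^-1` B)).
by rewrite -nbhs_subspace_out // => _ ->.
Qed.

Lemma continuousC_horner A (a b : C) (p : {poly C}) :
  {within A, continuous (fun t => (p.[seg a b t] : C^o))}.
Proof.
have cseg : {within A, continuous (fun t => (seg a b t : C^o))}.
  apply: continuousCD; first exact: continuousC_cst.
  apply: continuousCM; last exact: continuousC_cst.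
  apply: continuous_subspaceT => t.
  by exact (@cvg_realC R (nbhs t) _ idfun t (fun _ => id)).
elim/poly_ind: p => [|p c IH].
  rewrite (_ : (fun t => _) = fun=> 0); first exact: continuousC_cst.
  by apply/funext => t; rewrite horner0.
rewrite (_ : (fun t => _) = fun t => p.[seg a b t] * seg a b t + c).
  by apply: continuousCD; [exact: continuousCM | exact: continuousC_cst].
by apply/funext => t; rewrite !hornerE.
Qed.

(** Let s be the infimum of the points where f >= c. The step gives f s < c, which persists near s
    by continuity, yet such points lie arbitrarily close to s. *)
Lemma bootstrap_lt (f : R -> R) (c : R) :
  {within `[0, 1], continuous f} -> f 0 < c ->
  (forall u : R, 0 <= u <= 1 -> (forall t : R, 0 < t < u -> f t < c) -> f u < c) ->
  forall u : R, 0 <= u <= 1 -> f u < c.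
Proof.
move=> cf f0 step u u01; rewrite ltNge; apply/negP => cfu.
pose E := [set t : R | 0 <= t <= 1 /\ c <= f t].
have Eu : E u by [].
have lbE : lbound E 0 by move=> t [/andP[]].
have infE : has_inf E by split; [exists u | exists 0].
have s0 : 0 <= inf E by apply: lb_le_inf => //; exists u.
have su : inf E <= u by apply: ge_inf => //; exists 0.
have s01 : 0 <= inf E <= 1 by rewrite s0 (le_trans su) //; case/andP: u01.
have : f (inf E) < c.
  apply: step => // t /andP[t0 ts]; rewrite ltNge; apply/negP => cft.
  have /(ge_inf (ex_intro _ 0 lbE)) : E t.
    by split=> //; rewrite (ltW t0) (le_trans (ltW ts)) //; case/andP: s01.
  by rewrite leNgt ts.
set s := inf E in s0 su s01 *.
move=> fs.
have fs0 : 0 < c - f s by rewrite subr_gt0.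
have := cf s => /cvgrPdist_lt /(_ _ fs0).
change (@nbhs_subspace R `[0, 1]%classic s (fun t : R => `|f s - f t| < c - f s) -> False).
rewrite -nbhs_subspace_in; last by rewrite /= in_itv.
move=> /nbhs_ballP[d /= d0 ball_d].
have [t [t01 cft] ts] := inf_adherent d0 infE.
have st : s <= t by apply: ge_inf => //; exists 0.
have /= := ball_d t; rewrite in_itv /= => /(_ _ t01).
rewrite -ball_normE /= distrC ger0_norm ?subr_ge0 // ltrBlDl => /(_ ts).
rewrite ltr_norml => /andP[+ _].
by rewrite opprB ltrD2l ltrN2 ltNge cft.
Qed.

Lemma real_mean_value_le (f df : R -> R) (u K : R) : 0 <= u <= 1 -> 0 <= K ->
  {within `[0, 1], continuous f} ->
  (forall t : R, 0 < t < u -> is_derive t 1 f (df t) /\ `|df t| <= K) ->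
  `|f u - f 0| <= K.
Proof.
move=> /andP[]; rewrite le_eqVlt => /orP[/eqP <-|u0 u1] K0 cf df'.
  by rewrite subrr normr0.
have cu : {within `[0, u], continuous f}.
  by apply: continuous_subspaceW cf => t /=; rewrite !in_itv /= => /andP[-> /le_trans->].
have du t : t \in `]0, u[ -> is_derive t 1 f (df t).
  by rewrite in_itv /= => /df'[].
have [c] := MVT u0 du cu; rewrite in_itv /= => cI ->.
rewrite subr0 normrM (gtr0_norm u0) -[K]mulr1.
by apply: ler_pM; rewrite ?normr_ge0 ?(ltW u0) ?u1 //; case: (df' c cI).
Qed.

(** The mean value theorem fails for complex values; treating real and imaginary parts separately
    costs the factor 2. *)
Lemma mean_value_le Y dY (u K : R) : 0 <= u <= 1 -> 0 <= K ->
  {within `[0, 1], continuous (fun t => (Y t : C^o))} ->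
  (forall t, 0 < t < u -> has_cderiv Y t (dY t) /\ normc (dY t) <= K) ->
  normc (Y u - Y 0) <= 2 * K.
Proof.
move=> u01 K0 cY dYK.
rewrite (le_trans (normc_le_Re_Im _)) // !raddfB [2 * K]mulr_natl mulr2n lerD //.
- apply: (real_mean_value_le u01 K0 (continuous_Re cY)) => t /dYK[dYt le_dY].
  split; [exact: is_derive_Re dYt | exact: le_trans (normr_Re_le _) le_dY].
- apply: (real_mean_value_le u01 K0 (continuous_Im cY)) => t /dYK[dYt le_dY].
  split; [exact: is_derive_Im dYt | exact: le_trans (normr_Im_le _) le_dY].
Qed.

End MeanValue.

(** * Small solutions and the variation of the truncated first integral *)

Section FirstIntegral.
Variable R : realType.
Local Notation C := R[i].
Variables (a b : C) (p q : {poly C}) (eps : C).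

Lemma horner_seg_bound (f : {poly C}) :
  exists2 K : R, 0 <= K & forall t : R, 0 <= t <= 1 -> normc f.[seg a b t] <= K.
Proof.
have cf := continuous_normc (@continuousC_horner R `[0, 1] a b f).
have [c _ fc] := EVT_max ler01 cf.
by exists (normc f.[seg a b c]) => [|t t01]; rewrite ?normc_ge0 // fc // in_itv.
Qed.

(** Bootstrap with r = |Y 0|: while |Y| <= 3r/2, the derivative is at most 4(K1 + K2)r^2, so Y moves
    by at most 8(K1 + K2)r^2, which is below r/2 once r M < 1. *)
Lemma abel_solution_near : exists2 M : R, 0 < M &
  forall Y, abel_solution a b p q eps Y -> normc (Y 0) * M < 1 ->
    0 < normc (Y 0) ->
    forall t : R, 0 <= t <= 1 -> normc (Y t - Y 0) < normc (Y 0) / 2.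
Proof.
have [K1 K10 le_K1] := horner_seg_bound ((b - a) *: p).
have [K2 K20 le_K2] := horner_seg_bound (((b - a) * eps) *: q).
exists (16 * (K1 + K2) + 1) => [|Y [cY dY] rM r0].
  by rewrite ltr_wpDl ?mulr_ge0 ?addr_ge0.
set r := normc (Y 0) in rM r0 *.
(* The summand 1 in the constant gives this bound, which lets the cubic term be estimated by r^2. *)
have r1 : r < 1.
  by rewrite (le_lt_trans _ rM) // mulrDr mulr1 lerDr !mulr_ge0 ?addr_ge0 // ltW.
have cN : {within `[0, 1], continuous (fun t => normc (Y t - Y 0))}.
  by apply: continuous_normc; exact (continuousCD cY (@continuousC_cst R _ (- Y 0))).
apply: (bootstrap_lt cN) => [|u u01 near_u].
  by rewrite subrr normc0 divr_gt0.
have bound t : 0 < t < u -> normc ((b - a) * (p.[seg a b t] * Y t ^+ 3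
    + eps * q.[seg a b t] * Y t ^+ 2)) <= (4 * (K1 + K2) * r ^+ 2).
  move=> tu; have Yt : normc (Y t) <= r * (3 / 2).
    rewrite -[Y t](subrK (Y 0)) (le_trans (le_normcD _ _)) //.
    by have := near_u t tu; rewrite -/r; lra.
  have t01 : 0 <= t <= 1 by lra.
  have := le_K1 t t01; have := le_K2 t t01; rewrite !hornerZ => le2 le1.
  rewrite (_ : _ * _ = (b - a) * p.[seg a b t] * Y t ^+ 3
    + (b - a) * eps * q.[seg a b t] * Y t ^+ 2); last by ring.
  rewrite (le_trans (le_normcD _ _)) // !(normcM _ (_ ^+ _)) !normcX.
  have Y2 : normc (Y t) ^+ 2 <= 4 * r ^+ 2.
    have := normc_ge0 (Y t); nra.
  have Y3 : normc (Y t) ^+ 3 <= 4 * r ^+ 2.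
    have Y0 := normc_ge0 (Y t).
    have y2 : normc (Y t) ^+ 2 <= 9 / 4 * r ^+ 2 by nra.
    have y1 : normc (Y t) <= 3 / 2 by lra.
    rewrite exprS (le_trans (ler_pM Y0 (exprn_ge0 _ Y0) y1 y2)) //.
    by have := sqr_ge0 r; lra.
  rewrite [leRHS](_ : _ = K1 * (4 * r ^+ 2) + K2 * (4 * r ^+ 2)); last by ring.
  by apply: lerD; apply: ler_pM; rewrite ?normc_ge0 ?exprn_ge0 ?normc_ge0.
have : normc (Y u - Y 0) <= 2 * (4 * (K1 + K2) * r ^+ 2).
  apply: (mean_value_le u01 _ cY) => [|t tu].
    by rewrite !mulr_ge0 ?addr_ge0 ?exprn_ge0 // ltW.
  by split; [apply: dY; lra | exact: bound].
move=> /le_lt_trans; apply; nra.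
Qed.

Variable h : nat -> {poly C}.
Hypotheses (h0 : h 0 = 1) (dh1 : (h 1)^`() = (2 * eps) *: q).
Hypothesis dh : forall n, (h n.+2)^`() =
  - (((n%:R - 1) * eps) *: (q * h n.+1) + (n%:R - 2) *: (p * h n)).

(* T is the defect of the truncation S: d/dt (Y^-2 S_(n+2)) = (b - a) Y^n T_n. *)
Let S (Y : R -> C) n (t : R) : C := \sum_(i < n) (h i).[seg a b t] * Y t ^+ i.
Let T (Y : R -> C) n (t : R) : C :=
  (n%:R - 1) * (h n.+1).[seg a b t] *
    (eps * q.[seg a b t] + p.[seg a b t] * Y t)
  + (n%:R - 2) * (h n).[seg a b t] * p.[seg a b t].

(** Induction on n: h_(n+2)' cancels all of T_n except (n-1) h_(n+1) p Y, which joins the derivative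
    of Y^(n+2) to form Y T_(n+1). Not dividing by Y^2 here keeps the identity valid at zeros of
    Y. *)
Lemma has_cderiv_truncation Y n (t : R) : abel_solution a b p q eps Y -> 0 < t < 1 ->
  has_cderiv (S Y n.+2) t
    ((b - a) * (2 * (p.[seg a b t] * Y t ^+ 2 + eps * q.[seg a b t] * Y t)
                * S Y n.+2 t + Y t ^+ n.+2 * T Y n t)).
Proof.
move=> [_ dY] t01; have {}dY := dY t t01.
elim: n => [|n IH].
  pose proof (has_cderivD (has_cderiv_cst 1 t)
    (has_cderivM (has_cderiv_horner a b (h 1) t) dY)) as H.
  apply: has_cderiv_eq H => [s|].
    by rewrite /S !big_ord_recr big_ord0 /= h0 hornerC; ring.
  rewrite /S /T !big_ord_recr big_ord0 /= h0 hornerC dh1 hornerZ.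
  by ring.
pose proof (has_cderivD IH
    (has_cderivM (has_cderiv_horner a b (h n.+2) t) (has_cderivX n.+2 dY))) as H.
apply: has_cderiv_eq H => [s|]; first by rewrite /S [RHS]big_ord_recr.
rewrite /S [in RHS]big_ord_recr /= -/(S Y n.+2 t); move: (S Y n.+2 t) => s.
rewrite /T dh hornerN hornerD !hornerZ !hornerM.
rewrite -[_ *+ n.+2]mulr_natl -[n.+2%:R]natr1 -[n.+1%:R]natr1 !exprS.
by move: (Y t) n%:R => y k; ring.
Qed.

Lemma has_cderiv_first_integral Y n (t : R) : abel_solution a b p q eps Y ->
  0 < t < 1 -> Y t != 0 ->
  has_cderiv (fun t => S Y n.+2 t * (Y t)^-1 ^+ 2) t
    ((b - a) * (Y t ^+ n * T Y n t)).
Proof.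
move=> aY t01 Yt0; have dS := @has_cderiv_truncation Y n t aY t01.
have dYt := aY.2 t t01.
pose proof (has_cderivM dS (has_cderivX 2 (has_cderivV Yt0 dYt))) as H.
apply: has_cderiv_eq H => [//|].
rewrite !exprS; move: (S Y n.+2 t) (T Y n t) (Y t ^+ n) => s u z.
rewrite mulr2n /=.
by field.
Qed.

(** K has to be independent of the solution, because the radius r is chosen after it. The bound 2 on
    |Y| comes from |Y| <= 2r and r < 1. *)
Lemma first_integral_bound n : exists2 K : R, 0 <= K &
  forall (Y : R -> C) (t : R), 0 <= t <= 1 -> normc (Y t) <= 2 ->
    normc ((b - a) * T Y n t) <= K.
Proof.
have [K1 K10 le_K1] := horner_seg_bound ((b - a) *:
  ((n%:R - 1) *: (h n.+1 * (eps *: q)) + (n%:R - 2) *: (h n * p))).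
have [K2 K20 le_K2] := horner_seg_bound ((b - a) *:
  ((n%:R - 1) *: (h n.+1 * p))).
exists (K1 + K2 * 2) => [|Y t t01 Y2]; first by rewrite addr_ge0 ?mulr_ge0.
have := le_K1 t t01; have := le_K2 t t01; rewrite !(hornerZ, hornerM, hornerD) => le2 le1.
rewrite (_ : _ * T _ _ _ = (b - a) *
    ((n%:R - 1) * ((h n.+1).[seg a b t] * (eps * q.[seg a b t])) +
     (n%:R - 2) * ((h n).[seg a b t] * p.[seg a b t])) +
   (b - a) * ((n%:R - 1) * ((h n.+1).[seg a b t] * p.[seg a b t])) * Y t); last first.
  by rewrite /T; ring.
rewrite (le_trans (le_normcD _ _)) // lerD // normcM.
by apply: ler_pM; rewrite ?normc_ge0.
Qed.

Lemma small_radius (delta M B c : R) : 0 < delta -> 0 <= M -> 0 <= B -> 0 < c ->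
  exists2 r : R, 0 < r & [/\ r < delta, r < 1, r * M < 1 & r * B < c].
Proof.
(* Each summand of D enforces one of the four bounds on r = 1/D. *)
move=> d0 M0 B0 c0; pose D := 2 + delta^-1 + M + B / c.
have di0 : 0 < delta^-1 by rewrite invr_gt0.
have Bc0 : 0 <= B / c by rewrite divr_ge0 // ltW.
have D0 : 0 < D by rewrite /D; lra.
exists D^-1; first by rewrite invr_gt0.
split.
- by rewrite -[ltRHS]invrK ltf_pV2 ?posrE ?invr_gt0 // /D; lra.
- by rewrite invf_lt1 // /D; lra.
- by rewrite mulrC ltr_pdivrMr // mul1r /D; lra.
- by rewrite mulrC ltr_pdivrMr // -ltr_pdivrMl // mulrC /D; lra.
Qed.

(** Strong induction: once the lower coefficients vanish at b, the truncation changes by exactly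
    h_(n+1)(b) r^(n-1) along a closed solution, but by at most 2 (2r)^n K. Hence |h_(n+1)(b)| <=
    2^(n+1) K r, which is false for small r unless the left side is 0. *)
Lemma first_integral_end : has_center a b p q eps ->
  (forall n, (h n.+1).[a] = 0) -> forall n, (h n.+1).[b] = 0.
Proof.
move=> [delta d0 cen] ha; elim/ltn_ind => n IH.
have [M M0 near_M] := abel_solution_near.
have [K K0 le_K] := first_integral_bound n.
set c := normc (h n.+1).[b].
have [c0|c0] := eqVneq c 0; first exact: eq0_normc.
have {}c0 : 0 < c by rewrite lt_neqAle eq_sym c0 normc_ge0.
have B0 : 0 <= 2 ^+ n.+1 * K by rewrite mulr_ge0 ?exprn_ge0.
have [r r0 [rd r1 rM rB]] := small_radius d0 (ltW M0) B0 c0.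
have normr : normc r%:C = r by rewrite normc_real gtr0_norm.
have [|[Y [aY Y0]] /(_ Y aY Y0) Y1] := cen r%:C.
  by rewrite normr_normc normr ltcR.
have near_Y t : 0 <= t <= 1 -> normc (Y t - r%:C) < r / 2.
  by have := near_M Y aY; rewrite Y0 normr; apply.
have Yle t : 0 <= t <= 1 -> normc (Y t) <= 2 * r.
  move=> /near_Y Yt; rewrite -[Y t](subrK r%:C) (le_trans (le_normcD _ _)) //.
  by rewrite normr; lra.
have Yn0 t : 0 <= t <= 1 -> Y t != 0.
  move=> /near_Y; apply: contraTneq => ->.
  by rewrite sub0r normcN normr -leNgt; lra.
pose G t := S Y n.+2 t * (Y t)^-1 ^+ 2.
have cG : {within `[0, 1], continuous (fun t => (G t : C^o))}.
  apply: continuousCM.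
    apply: (@continuousC_sum R _ n.+2 (fun i t => (h i).[seg a b t] * Y t ^+ i)).
    move=> i; apply: continuousCM; first exact: continuousC_horner.
    exact: continuousCX aY.1.
  apply: continuousCX; apply: continuousC_V aY.1 => t /=.
  by rewrite in_itv; exact: Yn0.
have : normc (G 1 - G 0) <= 2 * ((2 * r) ^+ n * K).
  have r20 : 0 <= (2 * r) ^+ n by rewrite exprn_ge0 // mulr_ge0 // ltW.
  apply: (mean_value_le (dY := fun t => (b - a) * (Y t ^+ n * T Y n t)) _ _ cG);
    [by rewrite lexx ler01 | by rewrite mulr_ge0 | move=> t t01].
  have t01' : 0 <= t <= 1 by lra.
  split; first exact: (@has_cderiv_first_integral Y n t aY t01 (Yn0 t t01')).
  rewrite mulrCA normcM normcX; apply: ler_pM; rewrite ?exprn_ge0 ?normc_ge0 //.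
    by rewrite lerXn2r ?nnegrE ?normc_ge0 ?Yle // mulr_ge0 // ltW.
  by apply: le_K => //; rewrite (le_trans (Yle t t01')) //; lra.
(* As Y 1 = Y 0 = r, the terms h_0 = 1 cancel; at a nothing else survives, at b only the last
   term. *)
have -> : G 1 - G 0 = (h n.+1).[b] * r%:C ^+ n.+1 * (r%:C)^-1 ^+ 2.
  rewrite /G Y0 Y1 -mulrBl; congr (_ * _).
  have segE x : seg a b x = a + x%:C * (b - a) by [].
  rewrite /S Y0 Y1 !segE mul0r addr0 mul1r [a + _]addrC subrK.
  rewrite big_ord_recr [X in _ - X]big_ord_recl /= big_ord_recl /= h0 !hornerC.
  rewrite [X in _ - (_ + X)]big1 ?addr0 => [|i _]; last by rewrite ha mul0r.
  rewrite big1 ?addr0 => [|i _]; first by rewrite addrAC subrr add0r.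
  by rewrite /= IH ?mul0r.
rewrite !normcM !normcX normcV normr -/c => le_cr.
(* Multiplying by r^2 avoids the exponent n - 1, which is negative for n = 0. *)
have : c * r ^+ n.+1 <= 2 ^+ n.+1 * K * r * r ^+ n.+1.
  have : c * r ^+ n.+1 * r^-1 ^+ 2 * r ^+ 2 <= 2 * ((2 * r) ^+ n * K) * r ^+ 2.
    by rewrite ler_wpM2r // exprn_ge0 // ltW.
  rewrite exprVn mulfVK ?expf_neq0 ?gt_eqF // => /le_trans; apply.
  by rewrite exprMn !exprS le_eqVlt; apply/orP; left; apply/eqP; ring.
rewrite ler_pM2r ?exprn_gt0 // => le_c.
by have := lt_le_trans rB le_c; rewrite mulrC ltxx.
Qed.

End FirstIntegral.

Local Close Scope complex_scope.

(** * From a parametric center to vanishing moments and the dichotomy *)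

Section ParametricCenter.
Variable R : realType.
Local Notation C := R[i].
Variables (a b : C) (P Q : {poly C}).

Lemma parametric_center_fi_root : parametric_center a b P^`() Q^`() ->
  forall n j, (0 < n)%N -> ((fi a P^`() Q^`() n)`_j).[b] = 0.
Proof.
move=> center [//|n] j _; apply: coef_fi_root => e.
apply: (@first_integral_end R a b P^`() Q^`() e
  (fun n => (fi a P^`() Q^`() n).[e%:P])) (center e) _ n.
- by rewrite hornerC.
- exact: deriv_fi1_horner.
- exact: deriv_fi_horner.
- exact: fi_horner_root.
Qed.

Lemma closed_primitive_in_Z : in_calP a b Q ->
  (forall i, closed_primitive a b (P ^+ i * Q^`())) -> in_Z a b P Q.
Proof.
move=> PQ closed; split=> // i; have [G <- Gab] := closed i.
by rewrite seg_integral_primitive Gab subrr.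
Qed.

Lemma composition_condition_sym :
  composition_condition a b P Q -> composition_condition a b Q P.
Proof. by move=> [Pt [Qt [W [Wab [PE QE]]]]]; exists Qt, Pt, W. Qed.

End ParametricCenter.

Theorem theorem4p1 (R : realType) (a b : R[i]) (P Q : {poly R[i]}) :
  a != b ->
  P.[a] = 0 -> P.[b] = 0 -> Q.[a] = 0 -> Q.[b] = 0 ->
  parametric_center a b P^`() Q^`() ->
  composition_condition a b P Q \/
  (~ definite a b P /\ ~ definite a b Q /\ in_Z a b Q P /\ in_Z a b P Q).
Proof.
move=> _ Pa Pb Qa Qb /parametric_center_fi_root fib.
have ZP : in_Z a b P Q.
  by apply: closed_primitive_in_Z => // i; exact: closed_primitive_momentP fib i.
have ZQ : in_Z a b Q P.
  by apply: closed_primitive_in_Z => // i; exact: closed_primitive_momentQ fib i.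
have [CC|nCC] := pselect (composition_condition a b P Q); [by left | right].
split; first by move=> [_ defP]; apply/nCC/defP.
by split=> // -[_ defQ]; apply/nCC/composition_condition_sym/defQ.
Qed.
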